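(* (In ZFC.) The space $2^{\omega_1}$ contains a dense S-separable subspace.
   Context: $2^{\omega_1}$ is the product of $\omega_1$ copies of the two-point discrete space $\{0,1\}$ with the product topology. A space $X$ is S-separable if for every sequence $(Y_n)_{n\in\mathbb{N}}$ of dense subspaces of $X$ there exists a sequence $(F_n)_{n\in\mathbb{N}}$ such that each $F_n$ is a finite subset of $Y_n$ and for each finite collection $\mathcal{F}$ of nonempty open sets of $X$ there exists $n\in\mathbb{N}$ with $U\cap F_n\neq\emptyset$ for all $U\in\mathcal{F}$. *)

(* Defs.v *)
From mathcomp Require Import all_boot all_order.
From mathcomp Require Import boolp classical_sets functions cardinality topology.
From mathcomp Require wochoice.

Set Implicit Arguments.
Unset Strict Implicit.
Unset Printing Implicit Defensive.

Local Open Scope classical_set_scope.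

(* [R] is the non-strict order [<=]. Up to isomorphism, omega_1 is the unique
   uncountable well-order all of whose proper initial segments are countable. *)
Definition is_omega1 (I : Type) (R : rel I) : Prop :=
  [/\ wochoice.well_order R,
      ~ countable [set: I]
    & forall i : I, countable [set j | R j i]].

Definition S_separable (X : topologicalType) : Prop :=
  forall Y : nat -> set X, (forall n, dense (Y n)) ->
  exists F : nat -> set X,
    (forall n, finite_set (F n) /\ F n `<=` Y n) /\
    forall C : set (set X), finite_set C ->
      (forall U, C U -> open U /\ U !=set0) ->
      exists n, forall U, C U -> U `&` F n !=set0.

Lemma uncountable_natbool : ~ countable [set: nat -> bool].
Proof.
move=> /countable_injP[f finj].
have [g gE] : exists g : nat -> nat -> bool, forall x, exists n, g n = x.
  exists (fun n => xget (fun=> false) [set x | f x = n]) => x; exists (f x).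
  case: xgetP => [y _ /= fyx|/(_ x)/(_ erefl)//].
  by apply: finj; rewrite ?inE.
have [n /(congr1 (@^~ n))] := gE (fun n => ~~ g n n).
by case: (g n n).
Qed.

Lemma is_omega1_exists : exists (I : Type) (R : rel I), is_omega1 R.
Proof.
have [R woR] := wochoice.well_ordering_principle ((nat -> bool) : eqType).
pose W : set (nat -> bool) := [set x | countable [set y | R y x]].
have Rmin (A : set (nat -> bool)) :
    A !=set0 -> exists2 z, A z & forall y, A y -> R z y.
  move=> [x Ax]; have [|z [[/asboolP Az zA] _]] := woR (fun x => `[< A x >]).
    by exists x; apply/asboolP.
  by exists z => // y Ay; apply: zA; apply/asboolP.
have Rr z : R z z.
  by have [|_ -> /(_ z erefl)] := Rmin [set z]; first by exists z.
have Ranti x y : R x y -> R y x -> x = y.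
  move=> Rxy Ryx.
  have [|z [_ zu]] := woR (pred2 x y); first by exists x; rewrite inE eqxx.
  transitivity z; [symmetry|]; apply: zu; split; rewrite ?inE ?eqxx ?orbT//.
    by move=> t; rewrite !inE => /orP[]/eqP->.
  by move=> t; rewrite !inE => /orP[]/eqP->.
have Rtot x y : R x y \/ R y x.
  have [|z [->|->] h] := Rmin [set t | t = x \/ t = y]; first by exists x; left.
    by left; apply: h; right.
  by right; apply: h; left.
have Wunc : ~ countable W.
  move=> cW; have [WT|] := pselect (forall x, W x).
    apply: uncountable_natbool; rewrite (_ : setT = W)//.
    by apply/seteqP; split => x // _; exact: WT.
  move=> /existsNP Wm; have [m nWm mW] := Rmin (~` W) Wm.
  apply: nWm; rewrite /W /=.
  apply: (@sub_countable _ _ _ (W `|` [set m])).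
    apply: subset_card_le => y /= Rym.
    have [Wy|/mW Rmy] := pselect (W y); first by left.
    by right; exact: Ranti.
  rewrite -bigcup2E; apply: bigcup_countable => // -[|[|i]] _ /=; first exact: cW.
  - exact: countable1.
  - exact: countable0.
exists (set_type W), (fun a b => R (val a) (val b)); split.
- move=> A [a Aa].
  have [|_ [z Az <-] zA] := Rmin [set val b | b in [set b | b \in A]].
    by exists (val a), a.
  exists z; split => [|z' [Az' z'A]].
    by split => // b Ab; apply: zA; exists b.
  by apply: val_inj; apply: Ranti; [apply: zA; exists z'|apply: z'A].
- by move=> cW; apply: Wunc; rewrite -(eq_countable (card_setT W)).
- move=> [i Wi]; have /countable_injP[f finj] := set_mem Wi.
  apply/countable_injP; exists (f \o val) => a b; rewrite !inE /= => ai bi fab.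
  by apply: val_inj; apply: finj; rewrite ?inE.
Qed.

(* Main.v *)
(* The dense subspace consists of the traces on a set of points e i (i in
   omega_1) of the Cantor space of the clopen subsets of the Cantor space. It
   is countable, and a set of traces meets every open set of a given finite
   support A exactly when it shatters A, so one must choose finite F_n in Y_n
   such that every finite A is shattered by some F_n.
   If omega_1 < d, any countable dense D works: the number N(A, n) of elements
   of Y_n needed to shatter A gives omega_1 functions N(A, .), and they do not
   dominate some g, which tells how much of each Y_n to take.
   If d <= omega_1, a dominating family f is available and the points are all
   finite subsets of omega together with infinite sets e i whose gaps
   eventually exceed f A for every finite A below i. Let F_m shatter the first m
   points of a countable set C containing the finite subsets of omega. For any
   finite set of points e i with i large, the gaps leave arbitrarily far out a
   long interval [n, h n) missed by all of them; truncating these points at n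
   replaces them by points of C which the members of a suitable F_m cannot tell
   apart from them. Repeating this with larger and larger C reaches every finite
   set, since its traces on the sets C stabilise. *)
Require Import Defs.
From mathcomp Require Import all_boot all_order.
From mathcomp Require Import boolp classical_sets functions cardinality topology.
From mathcomp Require Import function_spaces.

Local Open Scope classical_set_scope.

(** * Finite and countable choice *)

Lemma finite_bound (T : Type) (A : set T) (P : T -> nat -> Prop) :
  finite_set A -> (forall x m n, m <= n -> P x m -> P x n) ->
  (forall x, A x -> exists n, P x n) ->
  exists n, forall x, A x -> P x n.
Proof.
elim/Pchoice: T => T in A P *; move=> /finite_seqP[s ->] mono.
elim: s => [|x s IHs] ex; first by exists 0.
have [|n Pn] := IHs; first by move=> y ys; apply: ex; rewrite /= inE ys orbT.
have [|m Pm] := ex x; first by rewrite /= inE eqxx.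
exists (maxn m n) => y; rewrite /= inE => /orP[/eqP->|ys].
  exact: mono (leq_maxl _ _) Pm.
exact: mono (leq_maxr _ _) (Pn _ ys).
Qed.

Lemma finite_choice (T U : Type) (A : set T) (Q : T -> set U) :
  finite_set A -> (forall x, A x -> Q x !=set0) ->
  exists2 B : set U, finite_set B &
    (forall x, A x -> Q x `&` B !=set0) /\ B `<=` \bigcup_(x in A) Q x.
Proof.
move=> finA exQ; have /choice[g gQ] : forall x, exists B : set U, A x ->
    exists2 u, Q x u & B = [set u].
  move=> x; have [Ax|nAx] := pselect (A x); last by exists set0.
  by have [u Qu] := exQ _ Ax; exists [set u] => _; exists u.
exists (\bigcup_(x in A) g x).
  by apply: bigcup_finite => // x /gQ[u _ ->]; exact: finite_set1.
split=> [x Ax|u [x Ax]]; have [v Qv gE] := gQ _ Ax.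
  by exists v; split => //; exists x => //; rewrite gE.
by rewrite gE => ->; exists x.
Qed.

Lemma countable_enum (T : Type) (A : set T) (x0 : T) :
  countable A -> exists u : nat -> T, A `<=` range u.
Proof.
elim/Pchoice: T => T in A x0 *; move=> /countable_injP[g ginj].
exists (fun n => xget x0 [set x | A x /\ g x = n]) => x Ax.
exists (g x) => //; case: xgetP => [y _ [Ay gyx]|/(_ x)[]//].
by apply: ginj; rewrite ?inE.
Qed.

(** * Shattering of finite sets of coordinates *)

Definition agree {I : Type} (A : set I) (y p : I -> bool) :=
  forall i, A i -> y i = p i.

Definition shatters {I : Type} (F : set (I -> bool)) (A : set I) :=
  forall p, exists2 y, F y & agree A y p.

Definition finitely_dense {I : Type} (Y : set (I -> bool)) :=
  forall A, finite_set A -> shatters Y A.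

Lemma finite_patterns (I : Type) (A : set I) : finite_set A ->
  exists2 P : set (I -> bool), finite_set P & shatters P A.
Proof.
elim/Pchoice: I => J in A *; move=> /finite_seqP[s ->].
exists (range (fun (t : (size s).-tuple bool) i => nth false t (index i s))).
  exact/finite_image/finite_finset.
move=> p; eexists; first by exists [tuple of map p (in_tuple s)].
by move=> i /= si; rewrite (nth_map i) ?index_mem ?nth_index.
Qed.

Lemma shatters_finite (I : Type) (Y : set (I -> bool)) (A : set I) :
  finite_set A -> shatters Y A ->
  exists F, [/\ finite_set F, F `<=` Y & shatters F A].
Proof.
move=> finA YA; have [P finP PA] := finite_patterns _ _ finA.
have [|F finF [PF FY]] := @finite_choice _ _ P
  (fun p => Y `&` [set y | agree A y p]) finP.
  by move=> p _; have [y Yy yp] := YA p; exists y.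
exists F; split => // [y /FY[p _ []]//|p].
have [q Pq qp] := PA p; have [y [[Yy yq] Fy]] := PF _ Pq.
by exists y => // i Ai; rewrite yq ?qp.
Qed.

(** * Selection in the absence of a dominating family *)

Definition selectable {I : Type} (D : set (I -> bool)) :=
  forall Y : nat -> set (I -> bool),
    (forall n, Y n `<=` D /\ finitely_dense (Y n)) ->
  exists F : nat -> set (I -> bool),
    (forall n, finite_set (F n) /\ F n `<=` Y n) /\
    forall A, finite_set A -> exists n, shatters (F n) A.

(* Such an [f] exists exactly when d <= omega_1, if [I] has cardinality omega_1. *)
Definition dominating {I : Type} (f : set I -> nat -> nat) :=
  forall h : nat -> nat, exists2 A, finite_set A &
    exists M, forall n, M <= n -> h n <= f A n.

(** Codes make each [Y n] an increasing union of finite sets; some [h] dominated by no [N (A, .)]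
    with [A] finite tells where to stop. *)
Lemma selectable_countable (I : Type) (D : set (I -> bool)) : countable D ->
  ~ (exists f : set I -> nat -> nat, dominating f) -> selectable D.
Proof.
move=> /countable_injP[code code_inj] nodom Y Yd.
pose hits (A : set I) n m := shatters [set y | Y n y /\ code y <= m] A.
have hitsP (An : set I * nat) : exists m, finite_set An.1 -> hits An.1 An.2 m.
  case: An => A n /=; have [finA|] := pselect (finite_set A); last by exists 0.
  have [|F [finF FY FA]] := shatters_finite _ (Y n) A finA; first exact: (Yd n).2.
  have [||m mP] := @finite_bound _ F (fun y m => code y <= m) finF.
  - by move=> y a b ab /leq_trans; exact.
  - by move=> y _; exists (code y).
  exists m => _ p; have [y Fy yp] := FA p.
  by exists y => //; split; [exact: FY|exact: mP].
have {hitsP} /choice[N NP] := hitsP.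
have [h hP] : exists h, forall A, finite_set A ->
    exists n, N (A, n) < h n.
  apply: contrapT => nh; apply: nodom; exists (fun A n => N (A, n)) => h.
  apply: contrapT => nA; apply: nh; exists h => A finA; apply: contrapT => nn.
  apply: nA; exists A => //; exists 0 => n _; rewrite leqNgt; apply/negP => lt.
  by apply: nn; exists n.
exists (fun n => [set y | Y n y /\ code y <= h n]); split => [n|A finA].
  split=> [|y []//].
  set G := [set y | _]; have injG : {in G &, injective code}.
    by apply: sub_in2 code_inj => y; rewrite !inE => -[/(Yd n).1].
  rewrite -(eq_finite_set (inj_card_eq injG)).
  apply: (sub_finite_set _ (finite_II (h n).+1)) => _ [y [_ yh] <-].
  by rewrite /= ltnS.
have [n lt] := hP _ finA; exists n => p.
have [y [Yy yN] yp] := NP (A, n) finA p.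
by exists y => //; split => //; exact: leq_trans yN (ltnW lt).
Qed.

(** * Cylinders and the product topology *)

Lemma ptws_open_cylinder (I : Type) (U : set {ptws I -> bool}) p :
  open U -> U p ->
  exists2 A : set I, finite_set A & [set q | agree A q p] `<=` U.
Proof.
move=> [/= B Bs <-] [W BW Wp].
have [E Es WE] := Bs _ BW.
have [|A finA [AE _]] := finite_choice _ _ _
  (fun V => [set i | exists X : set bool, [set q | X (q i)] = V])
  (finite_fset E).
  by move=> V /Es/set_mem[i _ [X _ XV]]; exists i, X.
exists A => // q qp; exists W => //; rewrite -WE => V EV.
have [i [[X XV] Ai]] := AE _ EV.
move: Wp; rewrite -WE => /(_ _ EV); rewrite -XV /=.
by rewrite (qp i Ai).
Qed.

Lemma cylinder_open (I : Type) (A : set I) (p : {ptws I -> bool}) :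
  finite_set A -> open [set q : {ptws I -> bool} | agree A q p].
Proof.
elim/Pchoice: I => I in A p *; move=> finA.
rewrite (_ : mkset _ =
    \bigcap_(i in A) (@^~ i @^-1` [set p i])); last first.
  by apply/seteqP; split => q qp i Ai; exact: qp.
move: finA => /finite_fsetP[E ->]; rewrite openE => q qp.
apply: filter_bigI => i Ei; apply: open_nbhs_nbhs; split; last exact: qp.
apply: open_comp; last exact: discrete_open.
by move=> r _; exact: (@proj_continuous I (fun=> bool) i r).
Qed.

Lemma dense_subspace (I : Type) (D : set {ptws I -> bool}) (Y : set (set_type D)) :
  finitely_dense D -> dense Y ->  finitely_dense ([set val y | y in Y] : set (I -> bool)).
Proof.
move=> Dd Yd A finA p.
have [||y [yp Yy]] := Yd [set y | agree A (val y) p].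
- have [y Dy yp] := Dd _ finA p; exists (exist _ y (mem_set Dy)); exact: yp.
- by exists [set q | agree A q p] => //; exact: cylinder_open.
by exists (val y) => //; exists y.
Qed.

(** Each nonempty open set contains a cylinder, so a set shattering the union of finitely many
    supports meets a whole finite family. *)
Lemma selectable_S_separable (I : Type) (D : set {ptws I -> bool}) :
  finitely_dense D -> selectable D -> dense D /\ S_separable (set_type D).
Proof.
move=> Dd Dsel; split=> [U [p Up] oU|Y Yd].
  have [A finA AU] := ptws_open_cylinder _ _ _ oU Up.
  by have [y Dy yp] := Dd _ finA p; exists y; split => //; exact: AU.
have [n|F [FY Fsh]] := Dsel (fun n => [set val y | y in Y n]).
  by split; [move=> _ [y _ <-]; exact: set_valP|exact: dense_subspace].
exists (fun n => val @^-1` F n); split => [n|C finC CU].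
  have [finF FYn] := FY n; split.
    by apply: finite_preimage => //; exact: in2W val_inj.
  by move=> y /FYn[z Yz /val_inj <-].
have /choice[A AP] : forall U : set (set_type D), exists A : set I, C U ->
    finite_set A /\ exists p : I -> bool,
      forall y : set_type D, agree A (val y) p -> U y.
  move=> U; have [CUU|] := pselect (C U); last by exists set0.
  have [[V oV <-] [y Vy]] := CU _ CUU.
  have [A finA AV] := ptws_open_cylinder _ _ _ oV Vy.
  by exists A; split => //; exists (val y) => z /AV.
have [|n nP] := Fsh (\bigcup_(U in C) A U).
  by apply: bigcup_finite => // U CUU; have [] := AP _ CUU.
exists n => U CUU; have [_ [p pU]] := AP _ CUU.
have [z Fz zp] := nP p; have [y _ yz] := (FY n).2 _ Fz; subst z.
by exists y; split => //; apply: pU => i Ai; apply: zp; exists U.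
Qed.

(** * Recursion along a well-order *)

(** Well-founded recursion in which the choice at [i] sees only the set of earlier values, which is
    countable. *)
Lemma wf_choice (I T : Type) (lt : I -> I -> Prop) (P : I -> set T -> T -> Prop) :
  well_founded lt -> (forall i, countable [set j | lt j i]) ->
  (forall i S, countable S -> exists y, P i S y) ->
  exists x : I -> T, forall i, P i (x @` [set j | lt j i]) (x i).
Proof.
move=> wf ctbl ex.
have /choice[step stepP] (iS : I * set T) :
    exists y, countable iS.2 -> P iS.1 iS.2 y.
  have [/(ex iS.1)[y Py]|nc] := pselect (countable iS.2); first by exists y.
  by have [y _] := ex iS.1 _ (countable0 T); exists y.
pose body i (rec : forall j, lt j i -> T) :=
  step (i, [set y | exists j (ji : lt j i), rec j ji = y]).
exists (Fix wf (fun=> T) body) => i; rewrite Fix_eq; last first.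
  move=> j g h gh; congr (step (_, _)).
  by apply/seteqP; split => y [k [kj <-]]; exists k, kj; rewrite gh.
rewrite /body (_ : [set y | exists j, _] =
    Fix wf (fun=> T) body @` [set j | lt j i]); last first.
  by apply/seteqP; split => [y [j [ji <-]]|y [j ji <-]]; exists j => //; exists ji.
apply: (stepP (i, _)) => /=.
by apply: sub_countable (ctbl i); exact: card_image_le.
Qed.

Section well_order.
Context (I : Type) (R : rel I) (woR : wochoice.well_order R).

Lemma well_order_min (A : set I) : A !=set0 ->
  exists2 z, A z & forall y, A y -> R z y.
Proof.
move=> [x Ax]; have [|z [[/asboolP Az zA] _]] := woR (fun x => `[< A x >]).
  by exists x; apply/asboolP.
by exists z => // y Ay; apply: zA; apply/asboolP.
Qed.

Lemma well_order_total x y : R x y \/ R y x.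
Proof.
have [|z [->|->] h] := well_order_min [set t | t = x \/ t = y].
- by exists x; left.
- by left; apply: h; right.
- by right; apply: h; left.
Qed.

Lemma well_order_antisym x y : R x y -> R y x -> x = y.
Proof.
move=> Rxy Ryx.
have [|z [_ zu]] := woR (fun t => `[< t = x \/ t = y >]).
  by exists x; apply/asboolP; left.
have Rr t : R t t by case: (well_order_total t t).
transitivity z; [symmetry|]; apply: zu; split.
- by apply/asboolP; left.
- by move=> t /asboolP[]->.
- by apply/asboolP; right.
- by move=> t /asboolP[]->.
Qed.

(** [~~ R j i] puts [i] strictly below [j]; a least inaccessible point would have only accessible
    predecessors. *)
Lemma well_order_wf : well_founded (fun i j => ~~ R j i).
Proof.
move=> i; apply: contrapT => ni.
have [|z nz zmin] := well_order_min [set i | ~ Acc (fun i j => ~~ R j i) i].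
  by exists i.
apply: nz; constructor => y; apply: contraNP; exact: zmin.
Qed.

End well_order.

(** * Sparse points of the Cantor space *)

Definition sparse (g : nat -> nat) (x : nat -> bool) :=
  exists M, forall a b, x a -> x b -> M <= a -> a < b -> g a < b.

Definition unbounded (x : nat -> bool) := forall n, exists2 a, n <= a & x a.

(** Diagonalisation: the term after [a k] exceeds [u j (a k)] for all [j <= k], so [u j] is obeyed
    from [a j] on. *)
Lemma sparse_exists (G : set (nat -> nat)) : countable G ->
  exists2 x, unbounded x & forall g, G g -> sparse g x.
Proof.
move=> /(@countable_enum _ _ id)[u Gu].
pose a := fix a n := if n is k.+1 then (a k + \max_(j < k.+1) u j (a k)).+1 else 0.
have a_lt : {homo a : m n / m < n}.
  apply: homo_ltn => //; first exact: ltn_trans.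
  by move=> n /=; rewrite ltnS leq_addr.
have n_le n : n <= a n.
  by elim: n => // n /leq_ltn_trans; apply; exact: a_lt.
have a_le : {homo a : m n / m <= n}.
  by apply: homo_leq => //; [exact: leq_trans|move=> n; exact/ltnW/a_lt].
exists (fun m => `[< exists n, a n = m >]) => [n|g /Gu[j _ <-]].
  by exists (a n) => //; apply/asboolP; exists n.
exists (a j) => _ _ /asboolP[n <-] /asboolP[m <-] jn nm.
have {}nm : n < m by rewrite ltnNge; apply: contraL nm => /a_le; rewrite -leqNgt.
have {}jn : u j (a n) < a n.+1.
  have [jn'|nj] := leqP j n.
    rewrite /= ltnS (leq_trans _ (leq_addl _ _))//.
    exact: (leq_bigmax (Ordinal (jn' : j < n.+1))).
  by move: (a_lt _ _ nj); rewrite ltnNge jn.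
exact: leq_trans jn (a_le _ _ nm).
Qed.

(* Making a new point sparse for such a [g] keeps it different from [x]; this is
   how the points [e i] below become distinct. *)
Lemma sparse_irrefl (x : nat -> bool) : unbounded x ->
  exists g, ~ sparse g x.
Proof.
move=> xu; have /choice[g gP] n : exists b, n < b /\ x b.
  by have [b nb xb] := xu n.+1; exists b.
exists g => -[M /=]; have [a Ma xa] := xu M.
by have [ag xg] := gP a => /(_ _ _ xa xg Ma ag); rewrite ltnn.
Qed.

Lemma infinite_injection (T : Type) : infinite_set [set: T] ->
  exists u : nat -> T, injective u.
Proof.
elim/Ppointed: T => T; first by rewrite emptyE => /(_ (finite_set0 _)).
by move=> /infiniteP/pcard_injP[u uinj]; exists u => m n; apply: uinj; rewrite inE.
Qed.

Lemma sparse_points (I : Type) (R : rel I) (f : set I -> nat -> nat) :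
  is_omega1 R -> exists (e : I -> nat -> bool) (K : set I),
  [/\ injective e, countable K,
      forall x n, exists2 i, K i & forall m, e i m = (m < n) && x m &
      forall i A, ~ K i -> finite_set A -> (forall j, A j -> R j i) ->
        sparse (f A) (e i)].
Proof.
move=> [woR uncI segI].
have /choice[g gP] (x : nat -> bool) : exists g, unbounded x -> ~ sparse g x.
  have [xu|] := pselect (unbounded x); last by exists id.
  by have [g gx] := sparse_irrefl x xu; exists g.
(* The point at [i] is sparse for the countably many [f A] with [A] finite and below [i], and for
   [g x] with [x] an earlier point, hence new. *)
have [||pts ptsP] := @wf_choice I (nat -> bool) _
  (fun i S y => [/\ unbounded y,
     forall A, finite_set A -> (forall j, A j -> R j i) -> sparse (f A) y &
     forall x, S x -> sparse (g x) y]) (well_order_wf _ _ woR).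
- move=> i; apply: sub_countable (segI i); apply: subset_card_le => j /=.
  by have [->|] := well_order_total _ _ woR i j.
- move=> i S cS; pose As := [set A | A `<=` [set j | R j i] /\ finite_set A].
  have [|y yu yP] := sparse_exists ((f @` As) `|` (g @` S)).
    rewrite -bigcup2E; apply: bigcup_countable => // -[|[|n]] _ /=.
    + apply: sub_countable (countable_finite_subset (segI i)).
      exact: card_image_le.
    + by apply: sub_countable cS; exact: card_image_le.
    + exact: countable0.
  exists y; split => // [A finA Ai|x Sx]; apply: yP; first by left; exists A.
  by right; exists x.
have pts_inj : injective pts.
  have ltP i j : ~~ R i j -> pts i <> pts j.
    move=> ij ptsE; have [iu _ /(_ (pts j))] := ptsP i.
    by rewrite -ptsE => /(_ (ex_intro2 _ _ j ij (esym ptsE))); exact: gP.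
  move=> i j ptsE; have [|/negP/negPn ij] := pselect (~~ R i j).
    by move=> /ltP.
  have [|/negP/negPn ji] := pselect (~~ R j i).
    by move=> /ltP; rewrite ptsE.
  exact: (well_order_antisym _ _ woR).
pose Fin := [set x : nat -> bool | exists n, forall m, n <= m -> x m = false].
have cFin : countable Fin.
  apply: (@sub_countable _ _ _ (range (fun s : seq bool => nth false s))).
    apply: subset_card_le => x [n xn]; exists (mkseq x n) => //.
    apply/funext => m; have [nm|mn] := leqP n m; last by rewrite nth_mkseq.
    by rewrite nth_default ?xn// size_mkseq.
  by apply: sub_countable (countableP [set: seq bool]); exact: card_image_le.
have /countable_injP[code code_inj] := cFin.
have [|u u_inj] := infinite_injection I.
  by move=> /finite_set_countable.
(* Every finite set [x] gets the index [u (code x)]; the remaining indices keep their unbounded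
   points. *)
pose e i := xget (pts i) [set x | Fin x /\ u (code x) = i].
have eP i : (Fin (e i) /\ u (code (e i)) = i) \/
    ~ ((u \o code) @` Fin) i /\ e i = pts i.
  rewrite /e; case: xgetP => [x _ []|nx]; first by left.
  by right; split => // -[x Fx xi]; apply: (nx x).
have ptsNFin i : ~ Fin (pts i).
  by move=> [n xn]; have [/(_ n)[m nm +] _ _] := ptsP i; rewrite xn.
exists e, ((u \o code) @` Fin); split.
- move=> i j eij; have [[Fi ui]|[_ ei]] := eP i; have [[Fj uj]|[_ ej]] := eP j.
  + by rewrite -ui -uj eij.
  + by case: (ptsNFin j); rewrite -ej -eij.
  + by case: (ptsNFin i); rewrite -ei eij.
  + by apply: pts_inj; rewrite -ei -ej.
- by apply: sub_countable cFin; exact: card_image_le.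
- move=> x n; pose y m := (m < n) && x m.
  have Fy : Fin y by exists n => m nm; rewrite /y ltnNge nm.
  exists (u (code y)); first by exists y.
  have [[Fe /u_inj ue]|[[]]] := eP (u (code y)); last by exists y.
  suff -> : e (u (code y)) = y by [].
  by apply: code_inj; rewrite ?inE.
- move=> i A nKi finA Ai.
  have [[Fe ue]|[_ ->]] := eP i; first by case: nKi; exists (e i).
  by have [_ + _] := ptsP i; apply.
Qed.

(** * Traces of clopen sets *)

(** A clopen subset of the Cantor space is encoded by a length and a finite list of words: its
    members have their prefix of that length listed. *)
Definition clopen_traces {I : Type} (e : I -> nat -> bool) : set (I -> bool) :=
  range (fun LS : nat * seq bitseq => fun i => mkseq (e i) LS.1 \in LS.2).

Lemma countable_clopen_traces (I : Type) (e : I -> nat -> bool) :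
  countable (clopen_traces e).
Proof.
apply: sub_countable (countableP [set: nat * seq bitseq]); exact: card_image_le.
Qed.

Lemma eq_mkseq_lt (T : Type) (f g : nat -> T) n :
  mkseq f n = mkseq g n <-> forall a, a < n -> f a = g a.
Proof.
split=> [fg a an|fg].
  by have := congr1 (nth (f a) ^~ a) fg; rewrite !nth_mkseq.
apply: (@eq_from_nth _ (f 0)); rewrite !size_mkseq// => a an.
by rewrite !nth_mkseq ?fg.
Qed.

Lemma clopen_traces_level (I : Type) (e : I -> nat -> bool) y :
  clopen_traces e y ->
  exists L, forall i j, (forall a, a < L -> e i a = e j a) -> y i = y j.
Proof. by move=> [[L S] _ <-]; exists L => i j /eq_mkseq_lt /= ->. Qed.

Lemma finite_separated (I : Type) (e : I -> nat -> bool) (A : set I) :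
  injective e -> finite_set A ->
  exists L, forall i j, A i -> A j ->
    (forall a, a < L -> e i a = e j a) -> i = j.
Proof.
move=> e_inj finA.
have [|||L LP] := @finite_bound _ (A `*` A) (fun ij L =>
  (forall a, a < L -> e ij.1 a = e ij.2 a) -> ij.1 = ij.2).
- exact: finite_setX.
- by move=> ij m n mn Pm eij; apply: Pm => a am; apply: eij; exact: leq_trans mn.
- move=> [i j] _ /=; have [->|nij] := pselect (i = j); first by exists 0.
  have [a aP] : exists a, e i a <> e j a.
    apply: contrapT => na; apply/nij/e_inj/funext => a; apply: contrapT => nea.
    by apply: na; exists a.
  by exists a.+1 => eij; case: aP; exact: eij.
by exists L => i j Ai Aj; exact: (LP (i, j)).
Qed.

Lemma clopen_traces_dense (I : Type) (e : I -> nat -> bool) :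
  injective e -> finitely_dense (clopen_traces e).
Proof.
elim/Pchoice: I => I in e *; move=> e_inj A finA p.
have [L LP] := finite_separated _ _ _ e_inj finA.
move: finA LP => /finite_seqP[s ->] LP; eexists.
  (* Prefixes of length [L] separate [A]; those of the points where [p] holds are listed. *)
  by exists (L, [seq mkseq (e a) L | a <- s & p a]).
move=> i si /=; apply/mapP/idP => [[a]|pi].
  by rewrite mem_filter => /andP[pa sa] /eq_mkseq_lt/LP ->.
by exists i => //; rewrite mem_filter pi.
Qed.

(** * Selection from a dominating family *)

(* Pigeonhole: [size s + 1] consecutive windows cannot all be met by the sets
   [x i], [i \in s], if each of them meets at most one window. *)
Lemma common_window (I : eqType) (s : seq I) (x : I -> nat -> bool)
    (h : nat -> nat) (M : nat) :
  (forall n, n < h n) ->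
  (forall i a b, i \in s -> x i a -> x i b -> M <= a -> a < b ->
     iter (size s).+1 h M <= b) ->
  exists2 n, M <= n & forall i a, i \in s -> n <= a < h n -> x i a = false.
Proof.
move=> h_gt x_gap; pose w k := iter k h M.
have w_le : {homo w : k l / k <= l}.
  by apply: homo_leq => //; [exact: leq_trans|move=> k /=; exact/ltnW/h_gt].
have M_le k : M <= w k by exact: (w_le 0).
apply: contrapT => nwin.
have /choice[c cP] k : exists ia : I * nat,
    [/\ ia.1 \in s, w k <= ia.2 < w k.+1 & x ia.1 ia.2].
  apply: contrapT => nk; apply: nwin; exists (w k) => // i a si ka.
  by apply/negP => xa; apply: nk; exists (i, a).
(* If [(c k).1 = (c l).1], the element in window [l] would lie beyond all [size s + 1] windows. *)
have c_neq k l : k < l -> l <= size s -> (c k).1 <> (c l).1.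
  move=> kl ls ckl; have [sk /andP[wk kw] xk] := cP k.
  have [_ /andP[wl lw]] := cP l; rewrite -ckl => xl.
  have ab : (c k).2 < (c l).2 by apply: leq_trans kw (leq_trans (w_le _ _ kl) wl).
  have := x_gap _ _ _ sk xk xl (leq_trans (M_le k) wk) ab.
  by rewrite leqNgt (leq_trans lw (w_le l.+1 (size s).+1 ls)).
have: size [seq (c k).1 | k <- iota 0 (size s).+1] <= size s.
  apply: uniq_leq_size => [|_ /mapP[k _ ->]]; last by have [] := cP k.
  rewrite map_inj_in_uniq ?iota_uniq// => k l.
  rewrite !mem_iota !add0n !ltnS /= => ks ls ckl.
  have [kl|lk|//] := ltngtP k l; first by case: (c_neq _ _ kl ls).
  by case: (c_neq _ _ lk ks).
by rewrite size_map size_iota ltnn.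
Qed.

(* [C] plays the role of the countable set of coordinates already dealt with;
   the new finite sets covered are those whose points outside [C] all lie
   beyond the countable set [C']. *)
Lemma select_step (I : Type) (R : rel I) (f : set I -> nat -> nat)
    (e : I -> nat -> bool) (K C : set I) (Y : nat -> set (I -> bool)) :
  dominating f -> injective e ->
  (forall x n, exists2 i, K i & forall m, e i m = (m < n) && x m) ->
  (forall i A, ~ K i -> finite_set A -> (forall j, A j -> R j i) ->
    sparse (f A) (e i)) ->
  (forall j, countable [set i | ~~ R j i]) ->
  countable C -> K `<=` C ->
  (forall n, Y n `<=` clopen_traces e /\ finitely_dense (Y n)) ->
  exists (F : nat -> set (I -> bool)) (C' : set I),
  [/\ forall n, finite_set (F n) /\ F n `<=` Y n, countable C', C `<=` C' &
      forall B, finite_set B -> B `&` C' `<=` C -> exists n, shatters (F n) B].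
Proof.
elim/Pchoice: I => I in R f e K C Y *.
move=> fdom e_inj Kfin e_sparse segR cC KC Yd.
have [i0 _ _] := Kfin xpredT 0.
have [c Cc] := countable_enum _ _ i0 cC.
have /choice[F FP] n : exists F, [/\ finite_set F, F `<=` Y n &
    shatters F (c @` `I_n)].
  apply: shatters_finite; first exact/finite_image/finite_II.
  by apply: (Yd n).2; exact/finite_image/finite_II.
have /choice[l lP] n : exists L, forall y, F n y ->
    forall i j, (forall a, a < L -> e i a = e j a) -> y i = y j.
  have [finF FY _] := FP n; apply: finite_bound => //.
    move=> y a b ab yP i j eij; apply: yP => m ma; apply: eij.
    exact: leq_trans ab.
  by move=> y /FY/(Yd n).1/clopen_traces_level.
(* The first [t n] points of [c] include all truncations at [n]. *)
have /choice[t tP] n : exists t, n <= t /\ forall x : nat -> bool,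
    exists2 k, k < t & forall m, e (c k) m = (m < n) && x m.
  have [P finP PI] := finite_patterns _ `I_n (finite_II n).
  have [||t tP] := @finite_bound _ P (fun x t => exists2 k, k < t &
      forall m, e (c k) m = (m < n) && x m) finP.
  - by move=> x a b ab [k ka kx]; exists k => //; exact: leq_trans ab.
  - move=> x _; have [i /KC/Cc[k _ <-] ix] := Kfin x n.
    by exists k.+1; exists k.
  exists (maxn n t); split=> [|x]; first exact: leq_maxl.
  have [q Pq qx] := PI x; have [k kt kq] := tP _ Pq.
  exists k => [|m]; first by rewrite leq_max kt orbT.
  by rewrite kq; case: ltnP => //= mn; rewrite qx.
(* Members of [F (t n)] do not separate points agreeing below [h n]; [n.+1] keeps the window
   nonempty. *)
pose h n := maxn n.+1 (l (t n)).
have h_gt n : n < h n by rewrite leq_max leqnn.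
(* One function bounds [iter k h M] for all [k, M <= a], whatever the number of windows and their
   start. *)
pose H a := \sum_(M < a.+1) \sum_(k < a.+1) iter k h M.
have H_ge a M k : M <= a -> k <= a -> iter k h M <= H a.
  move=> Ma ka; rewrite /H (bigD1 (Ordinal (Ma : M < a.+1)))//=.
  by rewrite (bigD1 (Ordinal (ka : k < a.+1)))//= -addnA leq_addr.
have [A finA [M0 M0P]] := fdom H.
(* A point outside this [C'] is above all of [A], so its gaps eventually exceed [f A], hence [H]. *)
exists F, (C `|` \bigcup_(j in A) [set i | ~~ R j i]); split.
- by move=> n; have [] := FP n.
- rewrite -bigcup2E; apply: bigcup_countable => // -[|[|n]] _ //=.
  by apply: bigcup_countable => //; exact: finite_set_countable.
- by left.
move=> B finB BC.
have B_sparse i : B i -> ~ C i -> sparse (f A) (e i).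
  move=> Bi nCi; apply: e_sparse => // [/KC//|j Aj].
  by apply: contrapT => /negP nji; apply/nCi/BC; split => //; right; exists j.
have [L LP] := finite_separated _ _ _ e_inj finB.
have [||N NP] := @finite_bound _ B (fun i n => C i -> exists2 k, k < n & c k = i)
  finB.
- by move=> i a b ab ia /ia[k ka <-]; exists k => //; exact: leq_trans ab.
- move=> i _; have [/Cc[k _ ki]|] := pselect (C i); last by exists 0.
  by exists k.+1; exists k.
have [||M1 M1P] := @finite_bound _ B (fun i M => ~ C i -> forall a b,
  e i a -> e i b -> M <= a -> a < b -> f A a < b) finB.
- by move=> i m n mn mP nCi a b xa xb na; apply: mP => //; exact: leq_trans na.
- move=> i Bi; have [Ci|nCi] := pselect (C i); first by exists 0.
  by have [M MP] := B_sparse i Bi nCi; exists M => _; exact: MP.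
have [s sE] : exists s : seq I, forall i, i \in s <-> B i /\ ~ C i.
  have [r rE] := (finite_seqP B).1 finB.
  exists [seq i <- r | `[< ~ C i >]] => i; rewrite mem_filter rE.
  by split => [/andP[/asboolP]|[? ?]] //; apply/andP; split => //; apply/asboolP.
(* From [M] on, [f A] dominates [H], the points of [B] outside [C] are sparse, prefixes separate
   [B], and [c] has listed [B] within [C]. *)
pose M := maxn (maxn M0 M1) (maxn (maxn N L) (size s).+1).
have [M0M M1M NM LM sM] : [/\ M0 <= M, M1 <= M, N <= M, L <= M & size s < M].
  by rewrite /M !leq_max !leqnn !orbT.
have [i a b /sE[Bi nCi] ea eb Ma ab|n Mn nP] := common_window _ s e h M h_gt.
  apply: leq_trans (ltnW (M1P _ Bi nCi _ _ ea eb (leq_trans M1M Ma) ab)).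
  apply: leq_trans (M0P a (leq_trans M0M Ma)).
  exact: H_ge (leq_trans sM Ma).
exists (t n) => p.
(* [q] copies [p] from the point of [B] with the same first [n] values, unique since [L <= n]. *)
pose q i := xget false [set b | exists j,
  [/\ B j, forall a, a < n -> e i a = e j a & b = p j]].
have qE i j : B j -> (forall a, a < n -> e i a = e j a) -> q i = p j.
  move=> Bj eij; rewrite /q; case: xgetP => [b _ [k [Bk eik ->]]|/(_ (p j))[]].
    congr p; apply: LP => // a aL.
    have an : a < n by apply: leq_trans aL (leq_trans LM Mn).
    by rewrite -eik ?eij.
  by exists j.
have [_ _ /(_ q)[y Fy yq]] := FP (t n).
have [nt tnP] := tP n; exists y => // i Bi.
have [Ci|nCi] := pselect (C i).
  have [k kN ki] := NP _ Bi Ci.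
  rewrite yq; first exact: qE.
  by exists k => //; exact: leq_trans kN (leq_trans NM (leq_trans Mn nt)).
have [k kt ek] := tnP (e i).
(* [c k] indexes the truncation of [e i] at [n]; since [e i] misses the window, [y] agrees on
   both. *)
transitivity (y (c k)).
  apply: (lP (t n) _ Fy) => a al; rewrite ek; have [//|na] := ltnP a n.
  rewrite (nP i)//; first exact/sE.
  by rewrite na /h leq_max al orbT.
rewrite yq; last by exists k.
by apply: qE => // a an; rewrite ek an.
Qed.

(** A pairing splits [Y] into infinitely many sequences, one for each use of [select_step] along the
    growing sets [C r]. *)
Lemma dominating_selectable (I : Type) (R : rel I) (f : set I -> nat -> nat)
    (e : I -> nat -> bool) (K : set I) :
  dominating f -> injective e -> countable K ->
  (forall x n, exists2 i, K i & forall m, e i m = (m < n) && x m) ->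
  (forall i A, ~ K i -> finite_set A -> (forall j, A j -> R j i) ->
    sparse (f A) (e i)) ->
  (forall j, countable [set i | ~~ R j i]) ->
  selectable (clopen_traces e).
Proof.
move=> fdom e_inj cK Kfin e_sparse segR Y Yd.
have /choice[G GP] (rC : nat * set I) :
    exists FC : (nat -> set (I -> bool)) * set I,
    countable rC.2 -> K `<=` rC.2 ->
    [/\ forall n, finite_set (FC.1 n) /\ FC.1 n `<=` Y (pickle (rC.1, n)),
        countable FC.2, rC.2 `<=` FC.2 &
        forall B, finite_set B -> B `&` FC.2 `<=` rC.2 ->
          exists n, shatters (FC.1 n) B].
  case: rC => r C /=; have [cC|] := pselect (countable C); last first.
    by exists (fun=> set0, set0).
  have [KC|] := pselect (K `<=` C); last by exists (fun=> set0, set0).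
  have [|F [C' FC]] := select_step _ _ _ _ _ _ (fun n => Y (pickle (r, n)))
    fdom e_inj Kfin e_sparse segR cC KC; first by move=> n; exact: Yd.
  by exists (F, C').
pose C := fix C n := if n is k.+1 then (G (k, C k)).2 else K.
have CP r : countable (C r) /\ K `<=` C r.
  elim: r => [|r [cC KC]]; first by split.
  have [_ cC' CC' _] := GP (r, C r) cC KC.
  by split => // i /KC/CC'.
have {}GP r := GP (r, C r) (CP r).1 (CP r).2.
have C_sub : {homo C : m n / m <= n >-> m `<=` n}.
  apply: homo_leq => [A//|A B D AB BD i /AB/BD//|r].
  by have [_ _ + _] := GP r.
exists (fun n =>
  if pickle_inv n is Some rm then (G (rm.1, C rm.1)).1 rm.2 else set0).
split=> [n|B finB].
  case: pickle_inv (@pickle_invK (nat * nat)%type n) => [[r m] /= <-|_].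
    by have [+ _ _ _] := GP r; exact.
  by split => // y [].
(* As [B] is finite, from some stage [r] on no new point of [B] enters the sets [C k]; step [r] then
   covers [B]. *)
have [||r rP] := @finite_bound _ B (fun i r => (exists k, C k i) -> C r i) finB.
- by move=> i m n mn Pm /Pm; exact: C_sub.
- move=> i _; have [[k Cki]|nC] := pselect (exists k, C k i); first by exists k.
  by exists 0 => /nC.
have [_ _ _ /(_ B finB)[|m mP]] := GP r.
  by move=> i [Bi Ci]; apply: rP => //; exists r.+1.
by exists (pickle (r, m)); rewrite pickleK_inv.
Qed.

Theorem theorem3p44 (I : Type) (R : rel I) (hI : is_omega1 R) :
  exists D : set {ptws I -> bool}, dense D /\ S_separable (set_type D).
Proof.
have [woR _ segI] := hI.
(* Fixing [f] before the case distinction lets the same points [e] serve both cases. *)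
have [f fP] : exists f : set I -> nat -> nat,
    (exists g : set I -> nat -> nat, dominating g) -> dominating f.
  have [[g gd]|] := pselect (exists g : set I -> nat -> nat, dominating g).
    by exists g.
  by exists (fun _ => id).
have [e [K [e_inj cK Kfin e_sparse]]] := sparse_points _ _ f hI.
exists (clopen_traces e); apply: selectable_S_separable.
  exact: clopen_traces_dense.
have [/fP fdom|] := pselect (exists g : set I -> nat -> nat, dominating g).
  apply: (dominating_selectable _ R f e K) => // j.
  apply: sub_countable (segI j); apply: subset_card_le => i /=.
  by have [->|] := well_order_total _ _ woR j i.
exact/selectable_countable/countable_clopen_traces.
Qed.
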